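(* For $1/4 \leq \theta < 1/2$, we have $g(\theta) \geq 1 - 2\theta$.
   Context: For $0 \leq \theta < 1/2$, $g(\theta)$ denotes the least (infimum) exponent $\gamma$ for which there exist constants $c_1, c_2 > 0$ (possibly depending on $\theta$) such that, for all sufficiently large real $x$, the interval $[x - c_1 x^{\gamma}, x + c_1 x^{\gamma}]$ contains an integer $n$ with $n = a_1 b_1 = a_2 b_2$, where $a_1 < a_2 \leq b_2 < b_1$ are integers in the interval $[x^{1/2} - c_2 x^\theta, x^{1/2} + c_2 x^\theta]$. (The inequality $g(\theta)\ge 1-2\theta$ means: for every $\gamma < 1-2\theta$ and all constants $c_1, c_2>0$, there are arbitrarily large $x$ for which $[x - c_1 x^{\gamma}, x + c_1 x^{\gamma}]$ contains no such integer $n$.) *)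

(* Defs.v *)
From HB Require Import structures.
From mathcomp Require Import all_boot all_order all_algebra.
From mathcomp Require Import all_classical all_reals all_analysis.

Set Implicit Arguments.
Unset Strict Implicit.
Unset Printing Implicit Defensive.

Import Order.TTheory GRing.Theory Num.Theory.

Local Open Scope classical_set_scope.
Local Open Scope ring_scope.

Definition near_sqrt (R : realType) (theta c2 x : R) (a : int) : Prop :=
  x `^ (2^-1) - c2 * x `^ theta <= a%:~R <= x `^ (2^-1) + c2 * x `^ theta.

Definition two_close_factorizations (R : realType) (theta c2 x : R) (n : int)
    : Prop :=
  exists a1 b1 a2 b2 : int,
    [/\ n = a1 * b1, n = a2 * b2,
        [/\ a1 < a2, a2 <= b2 & b2 < b1] &
        [/\ near_sqrt theta c2 x a1, near_sqrt theta c2 x b1,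
            near_sqrt theta c2 x a2 & near_sqrt theta c2 x b2]].

Definition admissible_exponent (R : realType) (theta gamma : R) : Prop :=
  exists c1 c2 : R, [/\ 0 < c1, 0 < c2 &
    \forall x \near +oo, exists n : int,
      x - c1 * x `^ gamma <= n%:~R <= x + c1 * x `^ gamma
      /\ two_close_factorizations theta c2 x n].

(* The infimum is taken in the extended reals, so that it is +oo, rather than
   a default real value, when no exponent is admissible. *)
Definition g (R : realType) (theta : R) : \bar R :=
  ereal_inf [set gamma%:E | gamma in [set gamma | admissible_exponent theta gamma]].

(* Main.v *)
(* If n = a1 b1 = a2 b2 with a1 < a2 <= b2 < b1, then for some positive r, h, s, k
   one has a1 = r s, a2 = r (s + h), b2 = s (r + k) and b1 = (r + k)(s + h).  When
   the four factors lie within c2 x^theta of sqrt x, both r h = a2 - a1 and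
   s k = b2 - a1 are at most 2 c2 x^theta, so each of the pairs (r, h) and (s, k)
   takes O(x^(theta + eps)) values, and only O(x^(2 theta + 2 eps)) integers n
   occur below x.  If gamma < 1 - 2 theta, there are more pairwise disjoint
   intervals of radius c1 x^gamma in [x / 2, x] than that. *)
Require Import Defs.
From mathcomp Require Import all_boot all_order all_algebra.
From mathcomp Require Import all_classical all_reals all_analysis.
From mathcomp Require Import zify lra ring.

Import Order.TTheory GRing.Theory Num.Theory.

Local Open Scope ring_scope.

(** Positive lattice points on or under the hyperbola [r * h = N]; the length is the summatory
    function of the number of divisors. *)
Definition hyperbola_pairs (N : nat) : seq (nat * nat) :=
  [seq (r, h) | r <- iota 1 N, h <- iota 1 (N %/ r)].

(* The integer a1 * b1 attached to p = (r, h) and q = (s, k). *)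
Definition four_product (p q : nat * nat) : nat :=
  (p.1 * q.1 * ((p.1 + q.2) * (q.1 + p.2)))%N.

Lemma mem_hyperbola_pairs (N r h : nat) :
  (0 < r * h <= N)%N -> (r, h) \in hyperbola_pairs N.
Proof.
rewrite muln_gt0 => /andP[/andP[r0 h0] rhN].
apply: allpairs_f_dep; rewrite mem_iota; first nia.
by rewrite h0 add1n ltnS leq_divRL // mulnC.
Qed.

(** Put [r = gcdn a1 a2], [a1 = s * r], [a2 = t * r]. Cancelling [r] leaves [s * b1 = t * b2] with
    [s], [t] coprime, so [s] divides [b2]; with [b2 = u * s] one gets [b1 = t * u], and the
    increments are [h = t - s], [k = u - r]. *)
Lemma four_product_factorization (a1 b1 a2 b2 : nat) :
  (0 < a1)%N -> (a1 < a2)%N -> (a2 <= b2)%N -> (a1 * b1 = a2 * b2)%N ->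
  exists p q, [/\ (p.1 * p.2 = a2 - a1)%N, (q.1 * q.2 = b2 - a1)%N
    & (a1 * b1 = four_product p q)%N].
Proof.
move=> a1_gt0 lt_a12 le_ab2 eq_ab.
set r := gcdn a1 a2.
have r_gt0 : (0 < r)%N by rewrite gcdn_gt0 a1_gt0.
have [s a1E] : exists s, a1 = (s * r)%N by apply/dvdnP/dvdn_gcdl.
have [t a2E] : exists t, a2 = (t * r)%N by apply/dvdnP/dvdn_gcdr.
have co_st : coprime s t.
  by rewrite /coprime -(eqn_pmul2r r_gt0) mul1n muln_gcdl -a1E -a2E.
have sb1E : (s * b1 = t * b2)%N.
  by apply/eqP; rewrite -(eqn_pmul2r r_gt0) mulnAC -a1E eq_ab a2E mulnAC.
have [u b2E] : exists u, b2 = (u * s)%N.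
  by apply/dvdnP; rewrite -(Gauss_dvdr _ co_st) -sb1E dvdn_mulr.
have s_gt0 : (0 < s)%N by case: (s) a1E a1_gt0 => // ->.
have b1E : b1 = (t * u)%N.
  by apply/eqP; rewrite -(eqn_pmul2l s_gt0) sb1E b2E mulnA [eqbRHS]mulnC.
have lt_st : (s < t)%N by rewrite -(ltn_pmul2r r_gt0) -a1E -a2E.
have lt_ru : (r < u)%N.
  by rewrite -(ltn_pmul2r s_gt0) -b2E mulnC -a1E (leq_trans lt_a12).
exists (r, t - s)%N, (s, u - r)%N; split => /=.
- by rewrite mulnBr mulnC (mulnC r) -a1E -a2E.
- by rewrite mulnBr mulnC -b2E -a1E.
- by rewrite /four_product /= !subnKC ?(ltnW lt_ru) ?(ltnW lt_st) //
    b1E a1E (mulnC s) (mulnC t).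
Qed.

Section RealBounds.
Context {R : realType}.
Implicit Types x y e c theta gamma : R.

Lemma ln_le_powR x e : 0 < x -> 0 < e -> ln x <= e^-1 * x `^ e.
Proof.
move=> x0 e0; rewrite ler_pdivlMl// -ln_powR.
have := @le_ln1Dx R (x `^ e - 1); rewrite [1 + _]addrC subrK.
have := powR_gt0 e x0; lra.
Qed.

Lemma harmonic_sum_le_ln (n : nat) :
  \sum_(1 <= r < n.+2) (r%:R : R)^-1 <= 1 + ln n.+1%:R.
Proof.
elim: n => [|n IHn]; first by rewrite big_nat1 invr1 ln1 addr0.
rewrite big_nat_recr//= (le_trans (lerD IHn (lexx _)))// -addrA lerD2l.
have n1 : (0 : R) < n.+1%:R by [].
have n2 : (0 : R) < n.+2%:R by [].
rewrite -lerBrDl -[leRHS]opprB lerNr.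
(* Writing the difference as ln (1 - 1/(n+2)) lets ln (1 + y) <= y bound the new term 1/(n+2). *)
have -> : ln n.+1%:R - ln n.+2%:R = ln (1 + - (n.+2%:R : R)^-1).
  rewrite -[- ln _]lnV ?posrE// -lnM ?posrE ?invr_gt0//; congr (ln _).
  rewrite -[n.+2%:R]natr1; move: (n.+1%:R : R) n1 => a a0.
  by field; lra.
by apply: le_ln1Dx; rewrite ltrN2 invf_lt1// ltr1n.
Qed.

(** The length is at most [N] times a harmonic sum, hence at most N (1 + ln N); then 1 <= N^e and ln
    N <= N^e / e. *)
Lemma size_hyperbola_pairs (N : nat) e : 0 < e ->
  (size (hyperbola_pairs N))%:R <= (1 + e^-1) * N%:R `^ (1 + e) :> R.
Proof.
move=> e0; case: N => [|n].
  by rewrite mulr_ge0 ?powR_ge0// addr_ge0// invr_ge0 ltW.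
rewrite size_allpairs_dep; set N := n.+1.
have N0 : (0 : R) < N%:R by [].
have -> : sumn [seq size (iota 1 (N %/ r)) | r <- iota 1 N]
        = (\sum_(1 <= r < N.+1) N %/ r)%N.
  rewrite sumnE big_map /index_iota subSS subn0.
  by apply: eq_bigr => r _; rewrite size_iota.
have ->: (1 + e^-1) * N%:R `^ (1 + e) = N%:R * (N%:R `^ e + e^-1 * N%:R `^ e).
  by rewrite powRD ?(gt_eqF N0) ?implybT// powRr1 ?ltW//; ring.
apply: (@le_trans _ _ (N%:R * \sum_(1 <= r < N.+1) (r%:R : R)^-1)).
  rewrite natr_sum mulr_sumr big_seq_cond [leRHS]big_seq_cond.
  apply: ler_sum => r; rewrite andbT mem_index_iota => /andP[r0 _].
  by rewrite ler_pdivlMr ?ltr0n// -natrM ler_nat leq_divM.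
rewrite ler_pM2l// (le_trans (harmonic_sum_le_ln n))// lerD ?ln_le_powR//.
by have := @ge0_ler_powR _ _ (ltW e0) 1 N%:R; rewrite powR1; apply; rewrite ?nnegrE ?ler1n.
Qed.

Lemma near_pinfty_powR_gt c e : 0 < e -> \forall x \near +oo, c < x `^ e.
Proof.
move=> e0; near=> x.
apply: (le_lt_trans (ler_norm c)).
have -> : `|c| = (`|c| `^ e^-1) `^ e.
  by rewrite -powRrM mulVf ?gt_eqF// powRr1.
by rewrite gt0_ltr_powR ?nnegrE ?powR_ge0.
Unshelve. all: by end_near. Qed.

(** The first bound makes [a1] positive, so all factors are natural numbers. The second puts the
    integers [a2 - a1] and [b2 - a1] strictly below [N.+1], hence at most [N]. *)
Lemma two_close_factorizations_four_product theta c x (n : int) (N : nat) :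
  c * x `^ theta < x `^ 2^-1 -> 2 * c * x `^ theta < N.+1%:R ->
  two_close_factorizations theta c x n ->
  exists2 m : nat, n = m &
    m \in [seq four_product p q | p <- hyperbola_pairs N, q <- hyperbola_pairs N].
Proof.
move=> cx_lt NxP [a1 [b1 [a2 [b2 [nE1 nE2 [lt_a12 le_ab2 lt_b21]]]]]].
rewrite /near_sqrt.
move=> [/andP[a1l a1u] /andP[b1l b1u] /andP[a2l a2u] /andP[b2l b2u]].
have a1_gt0 : 0 < a1 by rewrite -(ltr0z R); lra.
have diff_le (a : int) : a%:~R <= x `^ 2^-1 + c * x `^ theta ->
    (a - a1 <= N%:Z).
  by move=> au; rewrite -ltzD1 -(ltr_int R) rmorphB rmorphD/= -pmulrn natr1; lra.
have {}a2u := diff_le _ a2u; have {}b2u := diff_le _ b2u.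
clear diff_le a1l a1u b1l b1u a2l b2l.
case: a1 a1_gt0 lt_a12 nE1 a2u b2u => [a1|//] a1_gt0 lt_a12 nE1 a2u b2u.
case: a2 lt_a12 le_ab2 nE2 a2u => [a2|a2] lt_a12 le_ab2 nE2 a2u; last lia.
case: b2 le_ab2 lt_b21 nE2 b2u => [b2|b2] le_ab2 lt_b21 nE2 b2u; last lia.
case: b1 lt_b21 nE1 => [b1|b1] lt_b21 nE1; last lia.
have [p [q [pE qE abE]]] := @four_product_factorization a1 b1 a2 b2
  ltac:(lia) ltac:(lia) ltac:(lia) ltac:(lia).
exists (four_product p q); first by rewrite nE1 -PoszM abE.
apply: allpairs_f; [case: p pE {abE}|case: q qE {abE}] => i j /= ijE;
  apply: mem_hyperbola_pairs; lia.
Qed.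

Lemma admissible_exponent_le theta gamma gamma' : gamma <= gamma' ->
  admissible_exponent theta gamma -> admissible_exponent theta gamma'.
Proof.
move=> le_gamma [c1 [c2 [c1_gt0 c2_gt0 adm]]]; exists c1, c2; split => //.
near=> x.
have x_ge1 : 1 <= x by near: x; exact: nbhs_pinfty_ge.
have [n [/andP[n_ge n_le] n_fact]] : exists n : int,
    x - c1 * x `^ gamma <= n%:~R <= x + c1 * x `^ gamma
    /\ two_close_factorizations theta c2 x n by near: x.
exists n; split => //.
have : c1 * x `^ gamma <= c1 * x `^ gamma' by rewrite ler_pM2l// ler_powR.
by move=> le_pow; apply/andP; split; lra.
Unshelve. all: by end_near. Qed.

End RealBounds.

Theorem theorem2 (R : realType) (theta : R)
    (theta_ge : 4^-1 <= theta) (theta_lt : theta < 2^-1) :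
  ((1 - 2 * theta)%:E <= g theta)%E.
Proof.
apply: le_ereal_inf_tmp => _ [gamma0 adm0 <-]; rewrite lee_fin leNgt.
apply/negP => gamma0_lt.
(* A nonnegative exponent makes the power monotone in its base, so one radius, taken at [Y], serves
   for all centres up to [Y]. *)
pose gamma := Num.max gamma0 0.
have gamma_ge0 : 0 <= gamma by rewrite le_max lexx orbT.
have gamma_lt : gamma < 1 - 2 * theta by rewrite gt_max gamma0_lt; lra.
have [c1 [c2 [c1_gt0 c2_gt0 adm]]] : admissible_exponent theta gamma.
  by apply: admissible_exponent_le adm0; rewrite le_max lexx.
(* The gap also serves as the epsilon of the divisor bound; a factor Y^(e (1 - 2 theta)) is then
   left to beat the constants. *)
pose e := 1 - 2 * theta - gamma.
have e_gt0 : 0 < e by rewrite /e; lra.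
(* The square counts the choices of two pairs, each bounded by [size_hyperbola_pairs] with N <= 2 c2
   Y^theta. *)
pose C := ((1 + e^-1) * (2 * c2) `^ (1 + e)) ^+ 2.
have C_ge0 : 0 <= C by exact: sqr_ge0.
(* All centres will lie in [Y/2, Y]. The 6 is the 3 of the spacing [w] times the 2 of the available
   length Y/2. *)
have [Y [Y_ge1 Y_gt admY sqrtY]] : exists Y : R,
    [/\ 1 <= Y, 6 * c1 * (C + 1) < Y `^ (e * (1 - 2 * theta)),
     forall x, Y / 2 <= x -> exists n : int,
       x - c1 * x `^ gamma <= n%:~R <= x + c1 * x `^ gamma
       /\ two_close_factorizations theta c2 x n
     & forall x, Y / 2 <= x -> c2 < x `^ (2^-1 - theta)].
  have eth_gt0 : 0 < e * (1 - 2 * theta) by rewrite mulr_gt0//; lra.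
  have hth_gt0 : 0 < 2^-1 - theta by lra.
  have [A1 [_ P1]] := adm.
  have [A2 [_ P2]] := near_pinfty_powR_gt c2 _ hth_gt0.
  have [A3 [_ P3]] := near_pinfty_powR_gt (6 * c1 * (C + 1)) _ eth_gt0.
  pose A := `|A1| + `|A2| + `|A3| + 1.
  have A1A : A1 < A.
    by rewrite /A; have := ler_norm A1; have := normr_ge0 A2; have := normr_ge0 A3; lra.
  have A2A : A2 < A.
    by rewrite /A; have := ler_norm A2; have := normr_ge0 A1; have := normr_ge0 A3; lra.
  have A3A : A3 < A.
    by rewrite /A; have := ler_norm A3; have := normr_ge0 A1; have := normr_ge0 A2; lra.
  have A_ge1 : 1 <= A.
    by rewrite /A; have := normr_ge0 A1; have := normr_ge0 A2; have := normr_ge0 A3; lra.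
  exists (2 * A); split; first lra.
  - by apply: P3; lra.
  - by move=> x xA; apply: P1; lra.
  - by move=> x xA; apply: P2; lra.
have Y_gt0 : 0 < Y by lra.
pose N := Num.truncn (2 * c2 * Y `^ theta).
have M_ge0 : 0 <= 2 * c2 * Y `^ theta by rewrite !mulr_ge0 ?powR_ge0 ?ltW.
have Nle : N%:R <= 2 * c2 * Y `^ theta by rewrite truncn_le.
have Nlt : 2 * c2 * Y `^ theta < N.+1%:R by have /andP[] := truncn_itv M_ge0.
pose s := [seq four_product p q | p <- hyperbola_pairs N, q <- hyperbola_pairs N].
(* Larger than the diameter 2 c1 Y^gamma, so intervals at this spacing are disjoint. *)
pose w := 3 * c1 * Y `^ gamma.
have w_gt0 : 0 < w by rewrite !mulr_gt0 ?powR_gt0.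
have size_s : (size s).+1%:R * w <= Y / 2.
  have D_le : (size s)%:R <= C * Y `^ (2 * theta * (1 + e)).
    rewrite size_allpairs natrM -expr2.
    have -> : C * Y `^ (2 * theta * (1 + e)) =
        ((1 + e^-1) * (2 * c2 * Y `^ theta) `^ (1 + e)) ^+ 2.
      rewrite (@powRM _ (2 * c2)) ?powR_ge0 ?mulr_ge0 ?(ltW c2_gt0)// -powRrM.
      have -> : Y `^ (2 * theta * (1 + e)) = (Y `^ (theta * (1 + e))) ^+ 2.
        by rewrite -powR_mulrn ?powR_ge0// -powRrM; congr (_ `^ _); ring.
      by rewrite /C; ring.
    rewrite ler_sqr ?nnegrE ?mulr_ge0 ?powR_ge0 ?addr_ge0 ?invr_ge0 ?(ltW e_gt0)//.
    rewrite (le_trans (size_hyperbola_pairs N _ e_gt0))// ler_wpM2l//.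
      by rewrite addr_ge0 ?invr_ge0 ?(ltW e_gt0).
    by apply: ge0_ler_powR; rewrite ?nnegrE //; lra.
  (* Absorbs the one extra interval needed for the pigeonhole: size s + 1 <= (C + 1) Y^(2 theta (1 +
     e)). *)
  have Y1 : 1 <= Y `^ (2 * theta * (1 + e)).
    rewrite -[leLHS](powRr0 Y) ler_powR// !mulr_ge0//; lra.
  (* The choice of e makes the three exponents add up to 1. *)
  have YE : Y = Y `^ (e * (1 - 2 * theta))
      * Y `^ (2 * theta * (1 + e)) * Y `^ gamma.
    rewrite -!powRD ?(gt_eqF Y_gt0) ?implybT// -[LHS]powRr1 ?ltW//.
    by congr (_ `^ _); rewrite /e; ring.
  rewrite ler_pdivlMr// [leRHS]YE /w -[(size s).+1]addn1 natrD.
  rewrite mulrA -mulrA [_ * 2]mulrC !mulrA ler_pM2r ?powR_gt0//.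
  set P := Y `^ (2 * theta * (1 + e)) in D_le Y1 *.
  have : 6 * c1 * (C + 1) * P <= Y `^ (e * (1 - 2 * theta)) * P.
    by rewrite ler_pM2r ?ltW//; lra.
  have : 6 * c1 * ((size s)%:R + 1) <= 6 * c1 * (C * P + P).
    by rewrite ler_pM2l ?lerD// mulr_gt0.
  lra.
pose x (i : nat) : R := Y / 2 + i%:R * w.
have x_ge i : Y / 2 <= x i by rewrite /x lerDl mulr_ge0// ltW.
have x_le i : (i <= size s)%N -> x i <= Y.
  move=> i_le; have : i%:R * w <= (size s).+1%:R * w.
    by rewrite ler_pM2r// ler_nat ltnW.
  by rewrite /x; lra.
(* The range condition sits under the existential so that [choice] applies to every [i]; past
   [size s] the witness 0 is a dummy. *)
have pt (i : nat) : exists m : nat, (i <= size s)%N ->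
    (x i - c1 * Y `^ gamma <= m%:R <= x i + c1 * Y `^ gamma) /\ m \in s.
  have [i_le|_] := leqP i (size s); last by exists 0%N.
  have xi_gt0 : 0 < x i by have := x_ge i; lra.
  have pow_le b : 0 <= b -> x i `^ b <= Y `^ b.
    by move=> b_ge0; apply: ge0_ler_powR; rewrite ?nnegrE ?x_le//; lra.
  have [n [n_near n_fact]] := admY _ (x_ge i).
  have lt_sqrt : c2 * x i `^ theta < x i `^ 2^-1.
    rewrite -[2^-1](subrK theta) powRD ?(gt_eqF xi_gt0) ?implybT//.
    by rewrite ltr_pM2r ?powR_gt0// sqrtY.
  have lt_N : 2 * c2 * x i `^ theta < N.+1%:R.
    by apply: le_lt_trans Nlt; rewrite ler_pM2l ?mulr_gt0// pow_le//; lra.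
  have [m nE ms] :=
    two_close_factorizations_four_product _ _ _ _ _ lt_sqrt lt_N n_fact.
  exists m => _; split => //; move: n_near; rewrite nE -pmulrn.
  have : c1 * x i `^ gamma <= c1 * Y `^ gamma by rewrite ler_pM2l ?pow_le.
  by move=> ? /andP[? ?]; apply/andP; split; lra.
have [f fP] := choice pt.
have f_inj : {in iota 0 (size s).+1 &, injective f}.
  have sep i j : (i < j <= size s)%N -> f i <> f j.
    move=> /andP[lt_ij le_js] fE.
    have [/andP[_ fi] _] := fP i (leq_trans (ltnW lt_ij) le_js).
    have [/andP[fj _] _] := fP j le_js.
    have : i.+1%:R * w <= j%:R * w by rewrite ler_pM2r// ler_nat.
    have : 0 < c1 * Y `^ gamma by rewrite mulr_gt0 ?powR_gt0.
    by move: fi fj; rewrite fE -natr1 /x /w; lra.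
  move=> i j; rewrite !mem_iota !add0n !ltnS => le_is le_js fE.
  case: (ltngtP i j) => // lt_ij.
  - by case: (sep i j); rewrite ?lt_ij.
  - by case: (sep j i); rewrite ?lt_ij.
(* Pigeonhole: [f] would give [(size s).+1] distinct members of [s]. *)
have := @uniq_leq_size _ (map f (iota 0 (size s).+1)) s.
rewrite map_inj_in_uniq// iota_uniq size_map size_iota ltnn => /(_ isT) sub.
suff: false by []; apply: sub => _ /mapP[i i_le ->].
by have [] := fP i; rewrite mem_iota in i_le.
Qed.
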